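(* Let $G$ be a reflection group acting on $V\cong\mathbb{R}^n$ with basic invariants $\pi_1,\dots,\pi_n$. Let $J \subseteq \{1,\dots,n\}$ and $0 \le t \le n$ be such that $\pi_J(V) = \pi_J(\mathcal{H}_t(G))$. Then $t \ge |J|$.
   Context: A (real) reflection group $G$ acting on a Euclidean space $V \cong \mathbb{R}^n$ is a finite group of orthogonal transformations generated by reflections. Its reflection arrangement is the set of reflection hyperplanes of all reflections in $G$; flats are intersections of reflection hyperplanes (including $V$ itself), and $\mathcal{H}_t(G)$ is the set of points of $V$ contained in a flat of dimension $t$. A set of basic invariants $\pi_1,\dots,\pi_n$ is a set of $n$ algebraically independent homogeneous generators of $\mathbb{R}[V]^G$, labelled by nondecreasing degree. For $J\subseteq\{1,\dots,n\}$, $\pi_J : V \to \mathbb{R}^{J}$ is the map $\pi_J(x) = (\pi_i(x) : i \in J)$. *)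

(* Defs.v *)
From HB Require Import structures.
From mathcomp Require Import all_boot all_order all_algebra all_fingroup.
From mathcomp Require Import mxrepresentation.
From mathcomp Require Import boolp classical_sets reals.
From mathcomp Require Import mpoly.

Set Implicit Arguments.
Unset Strict Implicit.
Unset Printing Implicit Defensive.

Import Order.TTheory GRing.Theory Num.Theory.

Local Open Scope ring_scope.

(* The Euclidean space V is the space 'rV[R]_n of row vectors with the        *)
(* standard inner product. A finite group of transformations of V is given as *)
(* a faithful representation rG of a finite group G; following the library's  *)
(* convention, g acts on V by x |-> x *m rG g.                                *)
Section ReflectionGroup.

Variables (R : realType) (gT : finGroupType) (G : {group gT}) (n : nat).
Variable rG : mx_representation R G n.

(* [rfix_mx rG [set g]] is the fixed space of g; for orthogonal rG g, being a *)
(* reflection means that this space has codimension exactly 1.                *)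
Definition reflections : {set gT} :=
  [set g in G | (\rank (rfix_mx rG [set g])).+1 == n]%SET.

Definition reflection_group : Prop :=
  [/\ mx_faithful rG,
      forall g, g \in G -> rG g *m (rG g)^T = 1%:M
    & G :=: <<reflections>>%g].

(* Subspaces are represented by the row spaces of matrices; the intersection  *)
(* over the empty S is all of V.                                              *)
Definition flat (S : {set gT}) : 'M[R]_n :=
  (\bigcap_(s in S) rfix_mx rG [set s]%SET)%MS.

Definition flat_points (t : nat) : set 'rV[R]_n :=
  [set x | exists S : {set gT},
     [/\ S \subset reflections, \rank (flat S) = t & (x <= flat S)%MS]]%classic.

Definition invariant_mpoly (p : {mpoly R[n]}) : Prop :=
  forall g, g \in G -> forall x : 'rV[R]_n, p.@[(x *m rG g) 0] = p.@[x 0].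

Definition basic_invariants (pi : n.-tuple {mpoly R[n]}) : Prop :=
  [/\ exists d : 'I_n -> nat,
        (forall i, tnth pi i \is (d i).-homog) /\
        {homo d : i j / (i <= j)%N},
      forall q : {mpoly R[n]}, q \mPo pi = 0 -> q = 0,
      forall i, invariant_mpoly (tnth pi i)
    & forall p, invariant_mpoly p -> exists q : {mpoly R[n]}, p = q \mPo pi].

End ReflectionGroup.

Definition subtuple_map (R : realType) (n : nat) (pi : n.-tuple {mpoly R[n]})
    (J : {set 'I_n}) (x : 'rV[R]_n) : {ffun {i | i \in J} -> R} :=
  [ffun i => (tnth pi (val i)).@[x 0]].

(* Main.v *)
(* If t < |J|, then the restrictions of the pi_j, j in J, to a t-dimensional   *)
(* flat are more than t polynomials in t variables, hence algebraically        *)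
(* dependent. Multiplying one such relation for each of the finitely many      *)
(* flats gives a nonzero polynomial vanishing on pi_J(H_t) = pi_J(V): this is  *)
(* a relation between the pi_j on all of V, against their independence.        *)
Require Import Defs.
From HB Require Import structures.
From mathcomp Require Import all_boot all_order all_algebra all_fingroup.
From mathcomp Require Import mxrepresentation.
From mathcomp Require Import boolp classical_sets reals.
From mathcomp Require Import mpoly.

Set Implicit Arguments.
Unset Strict Implicit.
Unset Printing Implicit Defensive.
Import GRing.Theory Num.Theory.
Local Open Scope ring_scope.

(** The relation on each flat comes from [subspace_algebraic_dependence], whose core is the
    dimension count of [mpoly_algebraic_dependence]. The hypothesis concerns values and independence
    concerns polynomials; [mpoly_fun_eq0] passes from one to the other. *)

Lemma poly_fun_eq0 (R : numDomainType) (p : {poly R}) :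
  (forall x, p.[x] = 0) -> p = 0.
Proof.
move=> p0; pose rs : seq R := [seq k%:R | k <- iota 0 (size p)].
apply: (@roots_geq_poly_eq0 _ p rs); last by rewrite size_map size_iota.
  by apply/allP => x _; apply/eqP/p0.
by rewrite map_inj_uniq ?iota_uniq // => i j /eqP; rewrite eqr_nat => /eqP.
Qed.

(** Serves to recover [p] from [muni p], its form as a univariate polynomial in the last variable;
    hence [p = 0] once [muni p = 0]. *)
Lemma mcoeff_muni (R : comNzRingType) n (p : {mpoly R[n.+1]}) (m : 'X_{1..n.+1}) :
  ((muni p)`_(m ord_max))@_[multinom m (widen_ord (leqnSn n) i) | i < n] = p@_m.
Proof.
rewrite muniE coef_sum raddf_sum [in RHS](mpolyE p) raddf_sum /=.
apply: eq_bigr => k _; rewrite mcoeffZ mcoeffX coefZ coefXn.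
have [mk|mk] := eqP.
  rewrite mulr1 mcoeffZ mcoeffX; congr (_ * (nat_of_bool _)%:R).
  apply/eqP/eqP => [|-> //]; move/mnmP => km; apply/mnmP => i; have [j ->|->] := unliftP ord_max i => //.
  have := km j; rewrite !mnmE; congr (k _ = m _);
  by apply: val_inj; rewrite /= /bump leqNgt ltn_ord.
rewrite mulr0 mcoeff0; case: eqP => [km|]; last by rewrite mulr0.
by rewrite km in mk.
Qed.

Lemma muni_horner (R : comNzRingType) n (p : {mpoly R[n.+1]}) (v : 'I_n.+1 -> R) :
  (map_poly (meval (fun i => v (widen_ord (leqnSn n) i))) (muni p)).[v ord_max]
  = p.@[v].
Proof.
rewrite muniE raddf_sum horner_sum mevalE; apply: eq_bigr => m _ /=.
rewrite map_polyZ /= map_polyXn hornerZ hornerXn mevalZ mevalX big_ord_recr /= mulrA.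
by congr (_ * _ * _); apply: eq_bigr => i _; rewrite mnmE.
Qed.

(** Induction on [n]: with the other variables fixed, [p] is a univariate polynomial vanishing
    everywhere, so each coefficient of [muni p] vanishes as a function. *)
Lemma mpoly_fun_eq0 (R : numDomainType) n (p : {mpoly R[n]}) :
  (forall v : 'I_n -> R, p.@[v] = 0) -> p = 0.
Proof.
elim: n p => [|n IHn] p p0.
  by have := p0 (fun=> 0); rewrite [p]nvar0_mpolyC mevalC => ->; rewrite mpolyC0.
suff p'0 : muni p = 0 by apply/mpolyP => m; rewrite -mcoeff_muni p'0 coef0 !mcoeff0.
apply/polyP => k; rewrite coef0; apply: IHn => w.
have -> : ((muni p)`_k).@[w] = (map_poly (meval w) (muni p))`_k by rewrite coef_map.
rewrite [map_poly _ _]poly_fun_eq0 ?coef0 // => c.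
pose v i := if unlift ord_max i is Some j then w j else c.
have vc : v ord_max = c by rewrite /v unlift_none.
rewrite -[RHS](p0 v) -muni_horner vc; congr (horner _ _); apply: eq_map_poly => q.
apply: meval_eq => j; rewrite /v.
have -> : widen_ord (leqnSn n) j = lift ord_max j.
  by apply: val_inj; rewrite /= /bump leqNgt ltn_ord.
by rewrite liftK.
Qed.

(** A bound [a.+1] on [msize] means degree at most [a], the zero polynomial included, so these
    bounds simply add. *)
Lemma msizeM_leq (R : idomainType) n (p q : {mpoly R[n]}) a b :
  (msize p <= a.+1)%N -> (msize q <= b.+1)%N -> (msize (p * q) <= (a + b).+1)%N.
Proof.
have [->|p0] := eqVneq p 0; first by rewrite mul0r msize0.
have [->|q0] := eqVneq q 0; first by rewrite mulr0 msize0.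
move=> pa qb; rewrite msizeM // -subn1 leq_subLR add1n -addSn -addnS.
by rewrite leq_add.
Qed.

Lemma msize_comp_mpolyX (R : idomainType) n m (p : m.-tuple {mpoly R[n]})
    (D : nat) (e : 'X_{1..m}) :
  (forall j, msize (tnth p j) <= D.+1)%N ->
  (msize ('X_[e] \mPo p) <= (mdeg e * D).+1)%N.
Proof.
move=> leD; rewrite comp_mpolyX mdegE big_distrl /=.
elim/big_rec2: _ => [|j s q _ IH]; first by rewrite msize1.
apply: msizeM_leq IH; elim: (e j) => [|k IHk]; first by rewrite expr0 msize1.
by rewrite exprS mulSn; apply: msizeM_leq.
Qed.

(* Counting dimensions: there are N^m monomials with exponents below N in m    *)
(* variables, and their values at p lie in a space of dimension (C N)^t,       *)
(* where C depends only on m and p; this is smaller than N^m once N > C^t.     *)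
Lemma mpoly_algebraic_dependence (F : fieldType) m t (p : m.-tuple {mpoly F[t]}) :
  (t < m)%N -> exists2 Q : {mpoly F[m]}, Q != 0 & Q \mPo p = 0.
Proof.
move=> lt_tm; pose D := \max_j msize (tnth p j).
have leD j : (msize (tnth p j) <= D.+1)%N.
  by apply: leqW; apply: (leq_bigmax j).
(* The existentials keep these numbers from being unfolded. *)
have [C CE] : exists C, C = (m * D).+1 by exists (m * D).+1.
have [N ltCN] : exists N, (C ^ t < N)%N by exists (C ^ t).+1.
have N0 : (0 < N)%N by apply: leq_ltn_trans ltCN.
have [K KE] : exists K, K = (C * N)%N by exists (C * N)%N.
pose mon r k (e : {ffun 'I_r -> 'I_k}) : 'X_{1..r} := [multinom val (e i) | i < r].
have mon_inj r k : injective (@mon r k).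
  move=> e e' /mnmP ee'; apply/ffunP => i; apply: val_inj.
  by have := ee' i; rewrite !mnmE.
(* A vector in the left kernel of [A] is the coefficient vector of a relation. *)
pose A := \matrix_(i < #|{ffun 'I_m -> 'I_N}|, j < #|{ffun 'I_t -> 'I_K}|)
  ('X_[mon _ _ (enum_val i)] \mPo p)@_(mon _ _ (enum_val j)).
have lt_dim : (#|{ffun 'I_t -> 'I_K}| < #|{ffun 'I_m -> 'I_N}|)%N.
  rewrite !card_ffun !card_ord KE expnMn.
  apply: (@leq_trans (N ^ t.+1)); last by rewrite leq_pexp2l.
  by rewrite expnS ltn_mul2r expn_gt0 N0.
have /rowV0Pn[v /sub_kermxP vA v0] : kermx A != 0.
  by rewrite kermx_eq0 neq_ltn (leq_ltn_trans (rank_leq_col A)).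
pose Q := \sum_i v 0 i *: 'X_[mon _ _ (enum_val i)].
exists Q.
  have [i vi] : exists i, v 0 i != 0 by apply/rV0Pn.
  apply: contraNneq vi => Q0; have := congr1 (mcoeff (mon _ _ (enum_val i))) Q0.
  rewrite mcoeff0 raddf_sum (bigD1 i) //= mcoeffZ mcoeffX eqxx mulr1.
  rewrite big1 ?addr0 => [->//|k ki]; rewrite mcoeffZ mcoeffX.
  by rewrite (inj_eq (@mon_inj _ _)) (inj_eq enum_val_inj) (negPf ki) mulr0.
have QE : Q \mPo p = \sum_i v 0 i *: ('X_[mon _ _ (enum_val i)] \mPo p).
  by rewrite raddf_sum; apply: eq_bigr => i _; rewrite /= comp_mpolyZ.
apply/mpolyP => e; rewrite QE raddf_sum /= mcoeff0.
have [/forallP eK|/forallPn[j]] := boolP [forall j, (e j < K)%N].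
  pose e' : {ffun 'I_t -> 'I_K} := [ffun j => Ordinal (eK j)].
  have -> : e = mon _ _ e' by apply/mnmP => j; rewrite mnmE ffunE.
  have /rowP/(_ (enum_rank e')) := vA; rewrite !mxE => vAe.
  by rewrite -[RHS]vAe; apply: eq_bigr => i _; rewrite !mxE enum_rankK mcoeffZ.
(* Exponents outside the columns of [A] do not occur: the composed monomials have degree at most
   [m * N * D], which is less than [K]. *)
rewrite -leqNgt => Kej; apply: big1 => i _; rewrite mcoeffZ.
apply/eqP; rewrite mulf_eq0 orbC mcoeff_eq0 msize_mdeg_ge //.
apply: leq_trans (msize_comp_mpolyX _ leD) _.
apply: (@leq_trans K); last first.
  by apply: leq_trans Kej _; rewrite mdegE (bigD1 j) //= leq_addr.
have le_deg : (mdeg (mon m N (enum_val i)) <= m * N)%N.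
  rewrite mdegE -[m in (_ <= m * _)%N]card_ord -sum_nat_const leq_sum // => k _.
  by rewrite mnmE; apply: ltnW (ltn_ord _).
have le_KD : ((mdeg (mon m N (enum_val i)) * D).+1 <= N + m * D * N)%N.
  by rewrite -add1n leq_add // mulnAC leq_mul2r le_deg orbT.
by rewrite KE CE mulSn.
Qed.

(** The linear forms [L] parametrize the subspace by [\rank U] coordinates; substituting them in [p]
    leaves too few variables for independence. *)
Lemma subspace_algebraic_dependence (F : fieldType) n m k
    (p : m.-tuple {mpoly F[n]}) (U : 'M[F]_(k, n)) :
  (\rank U < m)%N ->
  exists2 Q : {mpoly F[m]}, Q != 0 &
    forall x : 'rV_n, (x <= U)%MS -> Q.@[fun j => (tnth p j).@[x 0]] = 0.
Proof.
pose L := [tuple \sum_l row_base U l i *: 'X_l | i < n] : n.-tuple {mpoly F[\rank U]}.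
move=> /(mpoly_algebraic_dependence [tuple tnth p j \mPo L | j < m])[Q Q0 QL].
exists Q => // x; rewrite -(eq_row_base U) => /submxP[y ->].
have := congr1 (meval (y 0)) QL; rewrite meval0 comp_mpoly_meval => <-.
apply: meval_eq => j; rewrite tnth_mktuple comp_mpoly_meval.
apply: meval_eq => i; rewrite tnth_mktuple mxE raddf_sum.
by apply: eq_bigr => l _ /=; rewrite mevalZ mevalXU mulrC.
Qed.

Theorem proposition9 (R : realType) (gT : finGroupType) (G : {group gT})
    (n : nat) (rG : mx_representation R G n) (pi : n.-tuple {mpoly R[n]})
    (J : {set 'I_n}) (t : nat) :
  reflection_group rG ->
  basic_invariants rG pi ->
  (t <= n)%N ->
  (subtuple_map pi J @` [set: 'rV[R]_n] =
     subtuple_map pi J @` flat_points rG t)%classic ->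
  (#|J| <= t)%N.
Proof.
move=> _ [_ pi_indep _ _] _ imJ; rewrite leqNgt; apply/negP => lt_tJ.
pose p := [tuple tnth pi (enum_val j) | j < #|J|].
have /fin_all_exists2[Q Q0 Qp] (S : {set gT}) : exists2 Q : {mpoly R[#|J|]}, Q != 0 &
    \rank (flat rG S) = t -> forall x : 'rV_n, (x <= flat rG S)%MS ->
      Q.@[fun j => (tnth p j).@[x 0]] = 0.
  have [rS|rS] := eqVneq (\rank (flat rG S)) t; last first.
    (* Flats of another dimension get the neutral factor 1 in [P]. *)
    by exists 1; rewrite ?oner_neq0 // => /eqP; rewrite (negPf rS).
  have [|Q Q0 Qp] := @subspace_algebraic_dependence _ _ _ _ p (flat rG S).
    by rewrite rS.
  by exists Q.
pose P := \prod_S Q S.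
have PX0 : P \mPo [tuple 'X_(enum_val j) | j < #|J|] = 0 :> {mpoly R[n]}.
  apply: pi_indep; apply: mpoly_fun_eq0 => v; rewrite !comp_mpoly_meval.
  (* The value at [v] is also taken at a point [x] of some flat of dimension [t], where the factor
     [Q S] vanishes. *)
  have : (subtuple_map pi J @` [set: 'rV[R]_n])%classic
    (subtuple_map pi J (\row_i v i)) by exists (\row_i v i).
  rewrite imJ => -[x [S [_ rS xS]] /ffunP eq_x].
  rewrite rmorph_prod (bigD1 S) //= -[RHS](mul0r (\prod_(S' | S' != S)
    (Q S').@[fun j => (tnth p j).@[x 0]])).
  rewrite -(Qp S rS x xS).
  have E j : (tnth [tuple 'X_(enum_val j) | j < #|J|] j).@[
     fun i => (tnth pi i).@[v]] = (tnth p j).@[x 0].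
    rewrite !tnth_mktuple mevalXU; have := eq_x (Sub (enum_val j) (enum_valP j)).
    by rewrite !ffunE /= => ->; apply: meval_eq => i; rewrite mxE.
  by congr (_ * _); last apply: eq_bigr => S' _; apply: meval_eq.
have /eqP : P = 0.
  apply: mpoly_fun_eq0 => w.
  (* This sum extends [w] from [J] to all indices by 0. *)
  rewrite -[RHS](meval0 (fun i => \sum_(j | enum_val j == i) w j)) -PX0.
  rewrite comp_mpoly_meval; apply: meval_eq => j.
  rewrite tnth_mktuple mevalXU (big_pred1 j) // => k.
  by rewrite (inj_eq enum_val_inj).
by apply/negP/prodf_neq0.
Qed.
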